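(* Let $k$ be an algebraically closed field, let $\mathcal{C}$ be a connected, skeletal finite EI category and let $\hat{\mathcal{C}}$ be its free EI cover. Then the category algebra $k\mathcal{C}$ is a quotient algebra of $k\hat{\mathcal{C}}$. In particular, if $\hat{\mathcal{C}}$ is of finite representation type, so is $\mathcal{C}$.
   Context: A finite EI category is a small category with finitely many morphisms in which every endomorphism is an isomorphism. It is skeletal if isomorphic objects are equal, and connected if any two objects are joined by a finite chain of objects in which consecutive ones have a morphism between them in some direction. Composition is from right to left. The category algebra $k\mathcal{C}$ has the morphisms of $\mathcal{C}$ as a $k$-basis, with product $\alpha*\beta=\alpha\circ\beta$ if composable and $0$ otherwise. $\mathcal{C}$ is of finite representation type if $k\mathcal{C}$ is. A morphism $\alpha$ is unfactorizable if it is not an isomorphism and whenever $\alpha=\gamma\beta$, either $\beta$ or $\gamma$ is an isomorphism. For $x\ne y$ the set of unfactorizable morphisms $x\to y$ is an $(\mathrm{Aut}_{\mathcal{C}}(y),\mathrm{Aut}_{\mathcal{C}}(x))$-biset. Choosing one element from each orbit, for all pairs $(x,y)$, gives the set of representative unfactorizable morphisms. A finite EI quiver is a datum $\hat Q=(Q_0,Q_1,s,t,f,g)$ where $(Q_0,Q_1,s,t)$ is a finite acyclic quiver, $f$ assigns a finite group $f(v)$ to each vertex $v$, and $g$ assigns an $(f(t(\alpha)),f(s(\alpha)))$-biset to each arrow $\alpha$. It generates a category $\mathcal{C}_{\hat Q}$ with object set $Q_0$, $\mathrm{End}(v)=f(v)$, and, for $v\neq w$, $\mathrm{Hom}(v,w)=\bigsqcup_\gamma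 H_\gamma$ over all directed paths $\gamma$ from $v$ to $w$, where for $\gamma$ the path $v=v_0\xrightarrow{\alpha_1}v_1\to\cdots\xrightarrow{\alpha_n}v_n=w$, $H_\gamma=g(\alpha_n)\times_{f(v_{n-1})}\cdots\times_{f(v_1)}g(\alpha_1)$ (biset product: $X\times_K Y=(X\times Y)/((xk,y)\sim(x,ky))$). Composition is induced by the natural maps $H_{\gamma_2}\times H_{\gamma_1}\to H_{\gamma_2}\times_{f(v)}H_{\gamma_1}=H_{\gamma_2\gamma_1}$ and by the group multiplications and actions. A finite EI category is a finite free EI category if it is isomorphic to some $\mathcal{C}_{\hat Q}$. The free EI cover $\hat{\mathcal{C}}$ of $\mathcal{C}$ is the finite free EI category, unique up to isomorphism, admitting a full functor $\hat F:\hat{\mathcal{C}}\to\mathcal{C}$ such that $\hat{\mathcal{C}}$ and $\mathcal{C}$ have the same objects, isomorphisms and unfactorizable morphisms and $\hat F$ is the identity on these. Explicitly, $\hat{\mathcal{C}}=\mathcal{C}_{\hat Q}$ where $\hat Q$ has as vertices the objects of $\mathcal{C}$, one arrow $x\to y$ for each representative unfactorizable morphism $\alpha:x\to y$, $f(x)=\mathrm{Aut}_{\mathcal{C}}(x)$, and $g$ of that arrow is the biset orbit $\mathrm{Aut}_{\mathcal{C}}(y)\,\alpha\,\mathrm{Aut}_{\mathcal{C}}(x)$. *)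

(* Defs.v *)
From HB Require Import structures.
From mathcomp Require Import all_boot all_order all_algebra all_fingroup.

Set Implicit Arguments.
Unset Strict Implicit.
Unset Printing Implicit Defensive.
Import GRing.Theory.

Reserved Notation "g \oc f" (at level 40, left associativity).

Record finCat := FinCat {
  ob :> finType;
  hom : ob -> ob -> finType;
  idm : forall x, hom x x;
  comp : forall x y z, hom y z -> hom x y -> hom x z;
  comp1m : forall x y (f : hom x y), comp (idm y) f = f;
  compm1 : forall x y (f : hom x y), comp f (idm x) = f;
  compmA : forall x y z w (h : hom z w) (g : hom y z) (f : hom x y),
    comp h (comp g f) = comp (comp h g) f
}.
Arguments hom {C} x y : rename.
Arguments idm {C} x : rename.
Arguments comp {C x y z} : rename.
Notation "g \oc f" := (comp g f).

Section CategoryNotions.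
Variable C : finCat.

Definition is_iso (x y : C) (f : hom x y) : bool :=
  [exists g : hom y x, (g \oc f == idm x) && (f \oc g == idm y)].

Definition unfactorizable (x y : C) (f : hom x y) : bool :=
  ~~ is_iso f &&
  [forall z : C, forall b : hom x z, forall c : hom z y,
     (f == c \oc b) ==> is_iso b || is_iso c].

Definition EI_category : Prop := forall (x : C) (f : hom x x), is_iso f.

Definition skeletal : Prop :=
  forall x y : C, (exists f : hom x y, is_iso f) -> x = y.

Definition connected : Prop :=
  forall x y : C,
    connect [rel u v : C | (0 < #|hom u v|) || (0 < #|hom v u|)] x y.

End CategoryNotions.

Record functor (C D : finCat) := Functor {
  fob :> C -> D;
  fmap : forall x y, hom x y -> hom (fob x) (fob y);
  fmap1 : forall x, fmap (idm x) = idm (fob x);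
  fmapM : forall x y z (g : hom y z) (f : hom x y),
    fmap (g \oc f) = fmap g \oc fmap f
}.
Arguments fmap {C D} F {x y} : rename.

Definition full (C D : finCat) (F : functor C D) : Prop :=
  forall (x y : C) (g : hom (F x) (F y)), exists f : hom x y, fmap F f = g.

Definition cat_isomorphic (C D : finCat) : Prop :=
  exists F : functor C D,
    bijective F /\ forall x y : C, bijective (@fmap C D F x y).

Section CategoryAlgebra.
Local Open Scope ring_scope.

Definition mor (C : finCat) := {xy : C * C & hom xy.1 xy.2}.
Definition Mor (C : finCat) (x y : C) (f : hom x y) : mor C :=
  @existT _ (fun xy : C * C => hom xy.1 xy.2 : Type) (x, y) f.

(* {ffun mor C -> k} already carries the pointwise product, hence the alias.
   The ring may be zero (when C is empty), so that only the pzRing structure is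
   declared; cat_alg_scalerAl and cat_alg_scalerAr give the k-algebra axioms,
   cat_alg_basisM and cat_alg_basisM0 the product of basis elements. *)
Definition cat_alg (k : fieldType) (C : finCat) : Type := {ffun mor C -> k}.

Variables (k : fieldType) (C : finCat).
Implicit Types a b c : cat_alg k C.

HB.instance Definition _ := GRing.Lmodule.copy (cat_alg k C) {ffun mor C -> k^o}.

Definition cat_alg_coef a (m : mor C) : k := (a : {ffun mor C -> k}) m.
Local Notation "a .@ m" := (cat_alg_coef a m) (at level 2, format "a .@ m").

Definition cat_alg_basis (m : mor C) : cat_alg k C :=
  [ffun m' => (m' == m)%:R].

Definition cat_alg_one : cat_alg k C := \sum_(x : C) cat_alg_basis (Mor (idm x)).

Definition cat_alg_mul a b : cat_alg k C :=
  [ffun m : mor C =>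
     \sum_(y : C) \sum_(g : hom y (tag m).2)
       \sum_(f : hom (tag m).1 y | g \oc f == tagged m)
          cat_alg_coef a (Mor g) * cat_alg_coef b (Mor f)].

Lemma cat_algP a b :
  (forall (x y : C) (f : hom x y), a.@(Mor f) = b.@(Mor f)) -> a = b.
Proof. by move=> eqab; apply/ffunP => -[[x y] f]; apply: eqab. Qed.

Lemma coefD a b m : (a + b).@m = a.@m + b.@m.
Proof. exact: ffunE. Qed.

Lemma coefZ (l : k) a m : (l *: a).@m = l * a.@m.
Proof. exact: ffunE. Qed.

Lemma coefM a b (x z : C) (h : hom x z) :
  (cat_alg_mul a b).@(Mor h) =
  \sum_(y : C) \sum_(g : hom y z) \sum_(f : hom x y)
     (g \oc f == h)%:R * (a.@(Mor g) * b.@(Mor f)).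
Proof.
rewrite /cat_alg_coef ffunE; apply: eq_bigr => y _; apply: eq_bigr => g _ /=.
rewrite big_mkcond; apply: eq_bigr => f _.
by case: (g \oc f == h); rewrite ?mul1r ?mul0r.
Qed.

Lemma eq_Mor (x y : C) (f g : hom x y) : (Mor f == Mor g) = (f == g).
Proof.
apply/eqP/eqP => [eqm|-> //].
by apply/eqP; have/eqP := eqm; rewrite -tag_eqE /tag_eq eqxx tagged_asE.
Qed.

Lemma Mor_neq (x y x' y' : C) (f : hom x y) (g : hom x' y') :
  (x != x') || (y != y') -> (Mor f == Mor g) = false.
Proof. by apply: contraTF => /eqP[-> ->]; rewrite !eqxx. Qed.

Lemma sum_one (x z : C) (F : forall y : C, hom y z -> k) (g0 : hom x z) :
  \sum_(y : C) \sum_(g : hom y z) (Mor g == Mor g0)%:R * F y g = F x g0.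
Proof.
rewrite (bigD1 x) //= (bigD1 g0) //= eqxx mul1r big1 => [|g ne]; last first.
  by rewrite eq_Mor (negPf ne) mul0r.
rewrite addr0 big1 ?addr0 // => y ne; apply: big1 => g _.
by rewrite Mor_neq ?mul0r // ne.
Qed.

Lemma coef1 (x y : C) (f : hom x y) :
  cat_alg_one.@(Mor f) = (Mor f == Mor (idm y))%:R.
Proof.
rewrite /cat_alg_coef /cat_alg_one sum_ffunE (bigD1 y) //= ffunE big1 ?addr0 //.
by move=> u ne; rewrite ffunE Mor_neq // [y == u]eq_sym ne orbT.
Qed.

Lemma coef1' (x y : C) (f : hom x y) :
  cat_alg_one.@(Mor f) = (Mor f == Mor (idm x))%:R.
Proof.
rewrite coef1; case: (x =P y) f => [-> // | /eqP ne] f.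
by rewrite !Mor_neq ?ne ?orbT // eq_sym ne ?orbT.
Qed.

Lemma sum_one' (x z : C) (F : forall y : C, hom x y -> k) (f0 : hom x z) :
  \sum_(y : C) \sum_(f : hom x y) (Mor f == Mor f0)%:R * F y f = F z f0.
Proof.
rewrite (bigD1 z) //= (bigD1 f0) //= eqxx mul1r big1 => [|g ne]; last first.
  by rewrite eq_Mor (negPf ne) mul0r.
rewrite addr0 big1 ?addr0 // => y ne; apply: big1 => g _.
by rewrite Mor_neq ?mul0r // ne orbT.
Qed.

Lemma cat_alg_mul1l : left_id cat_alg_one cat_alg_mul.
Proof.
move=> b; apply: cat_algP => x z h; rewrite coefM.
pose F (y : C) (g : hom y z) := \sum_(f : hom x y) (g \oc f == h)%:R * b.@(Mor f).
rewrite (eq_bigr (fun y => \sum_(g : hom y z) (Mor g == Mor (idm z))%:R * F y g)).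
  rewrite sum_one /F (bigD1 h) //= comp1m eqxx mul1r big1 ?addr0 // => f ne.
  by rewrite comp1m (negPf ne) mul0r.
move=> y _; apply: eq_bigr => g _; rewrite /F mulr_sumr; apply: eq_bigr => f _.
by rewrite coef1 mulrCA.
Qed.

Lemma cat_alg_mul1r : right_id cat_alg_one cat_alg_mul.
Proof.
move=> a; apply: cat_algP => x z h; rewrite coefM.
pose F (y : C) (f : hom x y) := \sum_(g : hom y z) (g \oc f == h)%:R * a.@(Mor g).
rewrite (eq_bigr (fun y => \sum_(f : hom x y) (Mor f == Mor (idm x))%:R * F y f)).
  rewrite sum_one' /F (bigD1 h) //= compm1 eqxx mul1r big1 ?addr0 // => f ne.
  by rewrite compm1 (negPf ne) mul0r.
move=> y _; rewrite exchange_big; apply: eq_bigr => f _; rewrite /F mulr_sumr.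
by apply: eq_bigr => g _; rewrite coef1' mulrA mulrC.
Qed.

Lemma cat_alg_mulDl : left_distributive cat_alg_mul +%R.
Proof.
move=> a b c; apply: cat_algP => x z h; rewrite coefD !coefM -big_split.
apply: eq_bigr => y _; rewrite -big_split; apply: eq_bigr => g _.
by rewrite -big_split; apply: eq_bigr => f _; rewrite coefD mulrDl mulrDr.
Qed.

Lemma cat_alg_mulDr : right_distributive cat_alg_mul +%R.
Proof.
move=> a b c; apply: cat_algP => x z h; rewrite coefD !coefM -big_split.
apply: eq_bigr => y _; rewrite -big_split; apply: eq_bigr => g _.
by rewrite -big_split; apply: eq_bigr => f _; rewrite coefD !mulrDr.
Qed.

Lemma sum_eq (T : finType) (t : T) (F : T -> k) : \sum_(u : T) (t == u)%:R * F u = F t.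
Proof.
rewrite (bigD1 t) //= eqxx mul1r big1 ?addr0 // => u ne.
by rewrite eq_sym (negPf ne) mul0r.
Qed.

Lemma cat_alg_mulA : associative cat_alg_mul.
Proof.
move=> a b c; apply: cat_algP => x w h; rewrite !coefM.
pose T (y z : C) (p : hom z w) (q : hom y z) (s : hom x y) :=
  ((p \oc q) \oc s == h)%:R * (a.@(Mor p) * b.@(Mor q) * c.@(Mor s)).
transitivity (\sum_(z : C) \sum_(p : hom z w) \sum_(y : C) \sum_(q : hom y z)
               \sum_(s : hom x y) T y z p q s).
  apply: eq_bigr => z _; apply: eq_bigr => p _.
  under eq_bigr => f _ do rewrite coefM !mulr_sumr.
  rewrite exchange_big; apply: eq_bigr => y _.
  under eq_bigr => f _ do rewrite !mulr_sumr.
  rewrite exchange_big; apply: eq_bigr => q _.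
  under eq_bigr => f _ do rewrite !mulr_sumr.
  rewrite exchange_big; apply: eq_bigr => s _.
  rewrite (eq_bigr (fun f => (q \oc s == f)%:R *
    ((p \oc f == h)%:R * (a.@(Mor p) * (b.@(Mor q) * c.@(Mor s)))))).
    by rewrite sum_eq /T compmA -[X in _ = _ * X]mulrA.
  by move=> f _; rewrite [a.@_ * _]mulrCA [LHS]mulrCA.
symmetry.
transitivity (\sum_(y : C) \sum_(z : C) \sum_(p : hom z w) \sum_(q : hom y z)
               \sum_(s : hom x y) T y z p q s).
  apply: eq_bigr => y _.
  transitivity (\sum_(r : hom y w) \sum_(s : hom x y) \sum_(z : C)
     \sum_(p : hom z w) \sum_(q : hom y z) (p \oc q == r)%:R *
       ((r \oc s == h)%:R * (a.@(Mor p) * b.@(Mor q) * c.@(Mor s)))).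
    apply: eq_bigr => r _; apply: eq_bigr => s _.
    rewrite coefM mulr_suml mulr_sumr; apply: eq_bigr => z _.
    rewrite mulr_suml mulr_sumr; apply: eq_bigr => p _.
    rewrite mulr_suml mulr_sumr; apply: eq_bigr => q _.
    by rewrite -mulrA mulrCA.
  rewrite exchange_big.
  under eq_bigr => s _.
    rewrite exchange_big.
    under eq_bigr => z _.
      rewrite exchange_big.
      under eq_bigr => p _.
        rewrite exchange_big.
        under eq_bigr => q _ do rewrite sum_eq -/(T y z p q s).
        over.
      over.
    over.
  rewrite /= exchange_big; apply: eq_bigr => z _.
  rewrite exchange_big; apply: eq_bigr => p _.
  by rewrite exchange_big.
rewrite exchange_big; apply: eq_bigr => z _.
by rewrite exchange_big.
Qed.

HB.instance Definition _ := GRing.Zmodule_isPzRing.Build (cat_alg k C)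
  cat_alg_mulA cat_alg_mul1l cat_alg_mul1r cat_alg_mulDl cat_alg_mulDr.

Lemma cat_alg_scalerAl (l : k) a b : l *: (a * b) = (l *: a) * b.
Proof.
apply: cat_algP => x z h; rewrite coefZ !coefM mulr_sumr; apply: eq_bigr => y _.
rewrite mulr_sumr; apply: eq_bigr => g _; rewrite mulr_sumr; apply: eq_bigr => f _.
by rewrite coefZ mulrCA; congr (_ * _); rewrite mulrA.
Qed.

Lemma cat_alg_scalerAr (l : k) a b : l *: (a * b) = a * (l *: b).
Proof.
apply: cat_algP => x z h; rewrite coefZ !coefM mulr_sumr; apply: eq_bigr => y _.
rewrite mulr_sumr; apply: eq_bigr => g _; rewrite mulr_sumr; apply: eq_bigr => f _.
by rewrite coefZ mulrCA; congr (_ * _); rewrite mulrCA.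
Qed.

Lemma cat_alg_basisE a : a = \sum_(m : mor C) a.@m *: cat_alg_basis m.
Proof.
apply: cat_algP => x y f; rewrite /cat_alg_coef sum_ffunE (bigD1 (Mor f)) //=.
rewrite big1 => [|m ne]; rewrite !ffunE ?eqxx ?addr0 /GRing.scale /= ?mulr1 //.
by rewrite eq_sym (negPf ne) mulr0.
Qed.

Lemma cat_alg_basisM (x y z : C) (g : hom y z) (f : hom x y) :
  cat_alg_basis (Mor g) * cat_alg_basis (Mor f) = cat_alg_basis (Mor (g \oc f)).
Proof.
apply: cat_algP => x' z' h; rewrite coefM.
under eq_bigr => y' _ do under eq_bigr => g' _ do
  under eq_bigr => f' _ do rewrite /cat_alg_coef !ffunE.
rewrite /cat_alg_coef ffunE.
have [eqx|ne] := eqVneq x' x; last first.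
  rewrite (Mor_neq h) ?ne // big1 // => y' _; rewrite big1 // => g' _.
  by rewrite big1 // => f' _; rewrite (Mor_neq f') ?ne // !mulr0.
have [eqz|ne] := eqVneq z' z; last first.
  rewrite (Mor_neq h) ?ne ?orbT // big1 // => y' _; rewrite big1 // => g' _.
  by rewrite big1 // => f' _; rewrite (Mor_neq g') ?ne ?orbT // mul0r mulr0.
subst x' z'.
pose F (y' : C) (g' : hom y' z) : k :=
  \sum_(f' : hom x y') (g' \oc f' == h)%:R * (Mor f' == Mor f)%:R.
rewrite (eq_bigr (fun y' => \sum_(g' : hom y' z) (Mor g' == Mor g)%:R * F y' g')).
  rewrite sum_one /F eq_Mor eq_sym.
  rewrite (bigD1 f) //= eqxx mulr1 big1 ?addr0 // => f' ne.
  by rewrite eq_Mor (negPf ne) mulr0.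
move=> y' _; apply: eq_bigr => g' _; rewrite /F mulr_sumr; apply: eq_bigr => f' _.
exact: mulrCA.
Qed.

Lemma cat_alg_basisM0 (x y y' z : C) (g : hom y' z) (f : hom x y) :
  y != y' -> cat_alg_basis (Mor g) * cat_alg_basis (Mor f) = 0.
Proof.
move=> ne; apply: cat_algP => x1 z1 h; rewrite coefM /cat_alg_coef [RHS]ffunE.
rewrite big1 // => y1 _; rewrite big1 // => g1 _; rewrite big1 // => f1 _.
rewrite !ffunE; have [eqy|ney] := eqVneq y1 y.
  by rewrite (Mor_neq g1) ?eqy ?ne // mul0r mulr0.
by rewrite (Mor_neq f1) ?ney ?orbT // !mulr0.
Qed.

End CategoryAlgebra.

Section RepresentationType.
Local Open Scope ring_scope.
Variable A : pzRingType.

Definition submodule (M : lmodType A) (U : M -> Prop) : Prop :=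
  U 0 /\ forall (a : A) (u v : M), U u -> U v -> U (a *: u + v).

Definition indecomposable (M : lmodType A) : Prop :=
  (exists m : M, m != 0) /\
  forall U V : M -> Prop, submodule U -> submodule V ->
    (forall m, exists u v, [/\ U u, V v & m = u + v]) ->
    (forall m, U m -> V m -> m = 0) ->
    (forall u, U u -> u = 0) \/ (forall v, V v -> v = 0).

Definition finitely_generated (M : lmodType A) : Prop :=
  exists (n : nat) (e : 'I_n -> M),
    forall m : M, exists c : 'I_n -> A, m = \sum_(i < n) c i *: e i.

Definition module_isomorphic (M N : lmodType A) : Prop :=
  exists f : {linear M -> N}, bijective f.

(* For a finite-dimensional algebra, finitely generated modules are the
   finite-dimensional ones. *)
Definition finite_rep_type : Prop :=
  exists (n : nat) (N : 'I_n -> lmodType A),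
    (forall i, finitely_generated (N i) /\ indecomposable (N i)) /\
    (forall M : lmodType A, finitely_generated M -> indecomposable M ->
       exists i, module_isomorphic M (N i)).

End RepresentationType.

Section QuotientAlgebra.
Local Open Scope ring_scope.

(* B is a quotient of A: a surjective unital k-algebra morphism A -> B. *)
Definition is_quotient_cat_alg (k : fieldType) (C D : finCat) : Prop :=
  exists phi : {rmorphism cat_alg k D -> cat_alg k C},
    scalable phi /\ forall b, exists a, phi a = b.

End QuotientAlgebra.

Section Bisets.

Record biset (G H : finGroupType) := Biset {
  bcar :> finType;
  lact : G -> bcar -> bcar;
  ract : bcar -> H -> bcar;
  lact1 : forall x, lact 1%g x = x;
  lactM : forall g h x, lact (g * h)%g x = lact g (lact h x);
  ract1 : forall x, ract x 1%g = x;
  ractM : forall x g h, ract x (g * h)%g = ract (ract x g) h;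
  lractA : forall g x h, ract (lact g x) h = lact g (ract x h)
}.

Definition regular_biset (G : finGroupType) : biset G G :=
  @Biset G G G (fun g x => (g * x)%g) (fun x g => (x * g)%g)
    (@mul1g G) (fun g h x => esym (mulgA g h x)) (@mulg1 G) (@mulgA G)
    (fun g x h => esym (mulgA g x h)).

Section Product.
Variables (G K H : finGroupType) (X : biset G K) (Y : biset K H).

Definition bprod_rel : rel (X * Y) := fun p q =>
  [exists l : K, (p.1 == ract q.1 l) && (q.2 == lact l p.2)].

Lemma bprod_refl : reflexive bprod_rel.
Proof. by move=> [x y]; apply/existsP; exists 1%g; rewrite /= ract1 lact1 !eqxx. Qed.

Lemma bprod_sym : symmetric bprod_rel.
Proof.
suff sub p q : bprod_rel p q -> bprod_rel q p by move=> p q; apply/idP/idP; apply: sub.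
case/existsP=> l /andP[/eqP e1 /eqP e2]; apply/existsP; exists l^-1%g.
by rewrite e1 e2 -ractM -lactM mulgV mulVg ract1 lact1 !eqxx.
Qed.

Lemma bprod_trans : transitive bprod_rel.
Proof.
move=> q p r /existsP[l /andP[/eqP e1 /eqP e2]] /existsP[m /andP[/eqP e3 /eqP e4]].
by apply/existsP; exists (m * l)%g; rewrite ractM lactM -e3 -e1 -e2 -e4 !eqxx.
Qed.

Canonical bprod_equiv := EquivRel bprod_rel bprod_refl bprod_sym bprod_trans.

Definition bprod_car : Type := {eq_quot bprod_equiv}%qT.
HB.instance Definition _ := EqQuotient.on bprod_car.
HB.instance Definition _ := Choice.on bprod_car.
HB.instance Definition _ : isCountable bprod_car :=
  CanIsCountable (@reprK _ bprod_car).
HB.instance Definition _ : isFinite bprod_car :=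
  CanIsFinite (@reprK _ bprod_car).

Definition bprod_mk (x : X) (y : Y) : bprod_car := (\pi_bprod_car (x, y))%qT.

Lemma bprod_mkP (x x' : X) (y y' : Y) :
  bprod_mk x y = bprod_mk x' y' <-> exists l : K, x = ract x' l /\ y' = lact l y.
Proof.
split=> [/eqmodP/existsP[l /andP[/eqP e1 /eqP e2]]|[l [e1 e2]]]; first by exists l.
by apply/eqmodP/existsP; exists l; rewrite /= e1 e2 !eqxx.
Qed.

Lemma bprod_mk_bal (x : X) (l : K) (y : Y) :
  bprod_mk (ract x l) y = bprod_mk x (lact l y).
Proof. by apply/bprod_mkP; exists l. Qed.

Lemma bprod_repr (q : bprod_car) : bprod_mk (generic_quotient.repr q).1 (generic_quotient.repr q).2 = q.
Proof. by rewrite /bprod_mk -surjective_pairing reprK. Qed.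

Lemma bprod_ind (P : bprod_car -> Prop) :
  (forall x y, P (bprod_mk x y)) -> forall q, P q.
Proof. by move=> Pmk q; rewrite -(bprod_repr q). Qed.

Definition bprod_lact (g : G) (q : bprod_car) : bprod_car :=
  bprod_mk (lact g (generic_quotient.repr q).1) (generic_quotient.repr q).2.
Definition bprod_ract (q : bprod_car) (h : H) : bprod_car :=
  bprod_mk (generic_quotient.repr q).1 (ract (generic_quotient.repr q).2 h).

Lemma bprod_lactE g x y : bprod_lact g (bprod_mk x y) = bprod_mk (lact g x) y.
Proof.
have /bprod_mkP[l [e1 e2]] := bprod_repr (bprod_mk x y).
by rewrite /bprod_lact e1 -lractA bprod_mk_bal -e2.
Qed.

Lemma bprod_ractE x y h : bprod_ract (bprod_mk x y) h = bprod_mk x (ract y h).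
Proof.
have /bprod_mkP[l [e1 e2]] := bprod_repr (bprod_mk x y).
by rewrite /bprod_ract e1 bprod_mk_bal -lractA -e2.
Qed.

Lemma bprod_lact1 q : bprod_lact 1%g q = q.
Proof. by elim/bprod_ind: q => x y; rewrite bprod_lactE lact1. Qed.

Lemma bprod_lactM g h q : bprod_lact (g * h)%g q = bprod_lact g (bprod_lact h q).
Proof. by elim/bprod_ind: q => x y; rewrite !bprod_lactE lactM. Qed.

Lemma bprod_ract1 q : bprod_ract q 1%g = q.
Proof. by elim/bprod_ind: q => x y; rewrite bprod_ractE ract1. Qed.

Lemma bprod_ractM q g h : bprod_ract q (g * h)%g = bprod_ract (bprod_ract q g) h.
Proof. by elim/bprod_ind: q => x y; rewrite !bprod_ractE ractM. Qed.

Lemma bprod_lractA g q h :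
  bprod_ract (bprod_lact g q) h = bprod_lact g (bprod_ract q h).
Proof. by elim/bprod_ind: q => x y; rewrite !(bprod_lactE, bprod_ractE). Qed.

Definition bprod : biset G H :=
  @Biset G H bprod_car bprod_lact bprod_ract bprod_lact1 bprod_lactM bprod_ract1 bprod_ractM bprod_lractA.

End Product.
End Bisets.

(* Arrows are indexed by their source and target. *)
Record quiver := Quiver { vertex :> finType; arr : vertex -> vertex -> finType }.
Arguments arr {Q} v w : rename.

(* path_cons a p is the path p followed by the arrow a. *)
Inductive qpath (Q : quiver) (v : Q) : Q -> Type :=
| path_nil : qpath v v
| path_cons u w (a : arr u w) (p : qpath v u) : qpath v w.
Arguments path_nil {Q v}.
Arguments path_cons {Q v u w} a p.

Fixpoint plength (Q : quiver) (v w : Q) (p : qpath v w) : nat :=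
  if p is path_cons _ _ _ p' then (plength p').+1 else 0.

Definition acyclic (Q : quiver) : Prop :=
  forall (v : Q) (p : qpath v v), plength p = 0.

Record EI_quiver := EIQuiver {
  EIq_quiver :> quiver;
  EIq_acyclic : acyclic EIq_quiver;
  vgroup : EIq_quiver -> finGroupType;
  abiset : forall v w (a : arr v w), biset (vgroup w) (vgroup v)
}.
Arguments vgroup {Q} v : rename.
Arguments abiset {Q v w} a : rename.

Section PathFinite.
Variable Q : EI_quiver.

Definition EIpath (v w : Q) : Type := qpath v w.

Let arrow := {vw : Q * Q & arr vw.1 vw.2}.
Let Arrow (v w : Q) (a : arr v w) : arrow :=
  @existT _ (fun vw : Q * Q => arr vw.1 vw.2 : Type) (v, w) a.

Fixpoint path_code (v w : Q) (p : qpath v w) : seq arrow :=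
  if p is path_cons _ _ a p' then Arrow a :: path_code p' else [::].

Fixpoint path_decode (v w : Q) (s : seq arrow) : option (EIpath v w) :=
  match s with
  | [::] => if eqP is ReflectT e then Some (ecast w (EIpath v w) e path_nil) else None
  | a :: s' =>
    if path_decode v (tag a).1 s' is Some p then
      if (tag a).2 =P w is ReflectT e then
        Some (ecast w (EIpath v w) e (path_cons (tagged a) p)) else None
    else None
  end.

Lemma path_codeK (v w : Q) : pcancel (@path_code v w) (path_decode v w).
Proof.
elim=> [|u w' a p IHp] /=; first by case: eqP => // e; rewrite eq_axiomK.
by rewrite IHp; case: eqP => // e; rewrite eq_axiomK.
Qed.

HB.instance Definition _ (v w : Q) := Countable.copy (EIpath v w)
  (pcan_type (@path_codeK v w)).

Lemma path_code_uniq (v w : Q) (p : qpath v w) : uniq (path_code p).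
Proof.
have suffix v1 w1 (q : qpath v1 w1) a : a \in path_code q ->
    exists r : qpath (tag a).2 w1, True.
  elim: q => [//|u w' b q IHq] /=; rewrite inE => /predU1P[-> /=|/IHq[r _]].
    by exists path_nil.
  by exists (path_cons b r).
elim: p => [//|u w' a p IHp] /=; rewrite IHp andbT; apply/negP => /suffix[r _].
by have := EIq_acyclic (path_cons a r).
Qed.

Definition path_enum (v w : Q) : seq (EIpath v w) :=
  undup (pmap (path_decode v w)
    (flatten [seq [seq val t | t : n.-tuple arrow] | n <- iota 0 #|{: arrow}|.+1])).

Lemma path_enumP (v w : Q) : Finite.axiom (path_enum v w).
Proof.
move=> p; rewrite count_uniq_mem ?undup_uniq // mem_undup mem_pmap.
apply/eqP; rewrite eqb1; apply/mapP; exists (path_code p); last by rewrite path_codeK.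
apply/flatten_mapP; exists (size (path_code p)).
  rewrite mem_iota ltnS /=; have /card_uniqP <- := path_code_uniq p.
  exact: max_card.
by apply/mapP; exists (in_tuple (path_code p)); rewrite ?mem_enum.
Qed.

HB.instance Definition _ (v w : Q) := isFinite.Build (EIpath v w) (@path_enumP v w).

End PathFinite.

Section GeneratedCategory.
Variable Q : EI_quiver.

(* H_gamma, extended by f(v) on the trivial path at v.  On a path
   v_0 -> ... -> v_n it is g(a_n) x ... x g(a_1) x_f(v_0) f(v_0), where the last
   factor is the unit of the biset product. *)
Fixpoint path_biset (v w : Q) (p : qpath v w) : biset (vgroup w) (vgroup v) :=
  match p in qpath _ w return biset (vgroup w) (vgroup v) with
  | path_nil => regular_biset (vgroup v)
  | path_cons _ _ a p' => bprod (abiset a) (path_biset p')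
  end.

(* By acyclicity the only path from v to v is the trivial one, so that
   qhom v v is f(v). *)
Definition qhom (v w : Q) : finType :=
  {p : EIpath v w & path_biset p}.

Definition qelem (v w : Q) (p : qpath v w) (h : path_biset p) : qhom v w :=
  @existT _ (fun p : EIpath v w => path_biset p : Type) p h.

Definition qgrp (v : Q) (g : vgroup v) : qhom v v := @qelem v v path_nil g.

Definition qcons (v u w : Q) (a : arr u w) (x : abiset a) (m : qhom v u) :
    qhom v w :=
  @qelem v w (path_cons a (tag m)) (bprod_mk x (tagged m)).

Definition qlact (v w : Q) (g : vgroup w) (m : qhom v w) : qhom v w :=
  qelem (lact g (tagged m)).

(* The natural map H_p x H_p' -> H_(pp'); on a nontrivial p it sends
   ([x, h], h') to [x, hh'], and on a trivial p it is the left action. *)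
Fixpoint qcomp_path (v u w : Q) (p : qpath u w) :
    path_biset p -> qhom v u -> qhom v w :=
  match p in qpath _ w return path_biset p -> qhom v u -> qhom v w with
  | path_nil => fun g m => qlact g m
  | path_cons _ _ a p' => fun q m =>
      qcons (generic_quotient.repr q).1
        (@qcomp_path v u _ p' (generic_quotient.repr q).2 m)
  end.

Definition qcomp (v u w : Q) (m2 : qhom u w) (m1 : qhom v u) : qhom v w :=
  qcomp_path (tagged m2) m1.

Lemma qhom_ind (v : Q) (P : forall w, qhom v w -> Prop) :
  (forall g, P v (qgrp g)) ->
  (forall u w (a : arr u w) (x : abiset a) (m : qhom v u),
     P u m -> P w (qcons x m)) ->
  forall w (m : qhom v w), P w m.
Proof.
move=> P1 PS w [p]; elim: p => [g|u w' a p IHp q]; first exact: P1.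
by rewrite -(bprod_repr q); apply: (PS _ _ a _ (qelem _)); exact: IHp.
Qed.

Lemma qcons_bal (v u w : Q) (a : arr u w) (x : abiset a) l (m : qhom v u) :
  qcons (ract x l) m = qcons x (qlact l m).
Proof. by rewrite /qcons bprod_mk_bal. Qed.

Lemma qcomp_grp (v w : Q) g (m : qhom v w) : qcomp (qgrp g) m = qlact g m.
Proof. by []. Qed.

Lemma qlact_grp (v : Q) (g h : vgroup v) : qlact g (qgrp h) = qgrp (g * h)%g.
Proof. by []. Qed.

Lemma qlact_cons (v u w : Q) (a : arr u w) (x : abiset a) g (m : qhom v u) :
  qlact g (qcons x m) = qcons (lact g x) m.
Proof. by rewrite /qlact /= bprod_lactE. Qed.

Lemma qlact1 (v w : Q) (m : qhom v w) : qlact 1%g m = m.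
Proof. by case: m => p h; rewrite /qlact /= lact1. Qed.

Lemma qlactM (v w : Q) g h (m : qhom v w) : qlact (g * h)%g m = qlact g (qlact h m).
Proof. by case: m => p m; rewrite /qlact /= lactM. Qed.

Lemma qcomp_path_lact (v u w : Q) (p : qpath u w) g (h : path_biset p) (m : qhom v u) :
  qcomp_path (lact g h) m = qlact g (qcomp_path h m).
Proof.
elim: p => [|u' w' a p IHp] in g h m *; first exact: qlactM.
rewrite /= qlact_cons.
set x := (generic_quotient.repr h).1; set y := (generic_quotient.repr h).2.
have /bprod_mkP[l [-> e2]] := bprod_repr (bprod_mk (lact g x) y).
by rewrite qcons_bal -IHp -e2.
Qed.

Lemma qcomp_lact (v u w : Q) g (m2 : qhom u w) (m1 : qhom v u) :
  qcomp (qlact g m2) m1 = qlact g (qcomp m2 m1).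
Proof. exact: qcomp_path_lact. Qed.

Lemma qcomp_cons (v u u' w : Q) (a : arr u' w) (x : abiset a) (m2 : qhom u u')
    (m1 : qhom v u) :
  qcomp (qcons x m2) m1 = qcons x (qcomp m2 m1).
Proof.
rewrite /qcomp /=.
have /bprod_mkP[l [-> e2]] := bprod_repr (bprod_mk x (tagged m2)).
by rewrite qcons_bal -qcomp_path_lact -e2.
Qed.

Lemma qcomp1m (v w : Q) (m : qhom v w) : qcomp (qgrp 1%g) m = m.
Proof. exact: qlact1. Qed.

Lemma qcompm1 (v w : Q) (m : qhom v w) : qcomp m (qgrp 1%g) = m.
Proof.
elim/qhom_ind: w / m => [g|u w a x m IHm]; first by rewrite qcomp_grp qlact_grp mulg1.
by rewrite qcomp_cons IHm.
Qed.

Lemma qcompA (v u w z : Q) (m3 : qhom w z) (m2 : qhom u w) (m1 : qhom v u) :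
  qcomp m3 (qcomp m2 m1) = qcomp (qcomp m3 m2) m1.
Proof.
elim/qhom_ind: z / m3 => [g|w' z a x m IHm]; first by rewrite !qcomp_grp qcomp_lact.
by rewrite !qcomp_cons IHm.
Qed.

Definition quiver_cat : finCat :=
  @FinCat Q qhom (fun v => qgrp 1%g) qcomp qcomp1m qcompm1 qcompA.

End GeneratedCategory.

Definition free_EI_category (C : finCat) : Prop :=
  EI_category C /\ exists Q : EI_quiver, cat_isomorphic C (quiver_cat Q).

Definition bij_between (S T : Type) (P : pred S) (R : pred T) (h : S -> T) : Prop :=
  [/\ forall s, P s -> R (h s),
      forall s s', P s -> P s' -> h s = h s' -> s = s'
    & forall t, R t -> exists2 s, P s & h s = t].

(* Ch is a free EI cover of C.  "Having the same objects, isomorphisms and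
   unfactorizable morphisms, on which F is the identity" is expressed up to
   renaming: F is a bijection from those of Ch to those of C.  For C skeletal
   EI, cover_cat below is the explicit construction of such a Ch. *)
Definition free_EI_cover (Ch C : finCat) : Prop :=
  free_EI_category Ch /\
  exists F : functor Ch C,
    [/\ full F,
        bijective F,
        forall x y : Ch,
          bij_between (@is_iso Ch x y) (@is_iso C (F x) (F y)) (fmap F)
      & forall x y : Ch,
          bij_between (@unfactorizable Ch x y) (@unfactorizable C (F x) (F y))
            (fmap F)].

Section QuiverCatTheory.
Variable Q : EI_quiver.
Local Notation CQ := (quiver_cat Q).

Definition qlen (v w : Q) (m : qhom v w) : nat := plength (tag m).

Lemma qlen_cons (v u w : Q) (a : arr u w) (x : abiset a) (m : qhom v u) :
  qlen (qcons x m) = (qlen m).+1.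
Proof. by []. Qed.

Lemma qlen_comp (v u w : Q) (m2 : qhom u w) (m1 : qhom v u) :
  qlen (qcomp m2 m1) = qlen m2 + qlen m1.
Proof.
elim/qhom_ind: w / m2 => [g|u' w a x m IHm]; first by rewrite qcomp_grp.
by rewrite qcomp_cons !qlen_cons IHm.
Qed.

Lemma qlen_endo (v : Q) (m : qhom v v) : qlen m = 0.
Proof. exact: EIq_acyclic. Qed.

Lemma qlen0P (v w : Q) (m : qhom v w) : qlen m = 0 ->
  exists (e : v = w) (g : vgroup v), m = ecast w (qhom v w) e (qgrp g).
Proof. by elim/qhom_ind: w / m => [g _|//]; exists erefl, g. Qed.

Lemma qhom_endoP (v : Q) (m : qhom v v) : exists g, m = qgrp g.
Proof. by have [e [g ->]] := qlen0P (qlen_endo m); rewrite eq_axiomK; exists g. Qed.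

Lemma qlen1P (v w : Q) (m : qhom v w) : qlen m = 1 ->
  exists (a : arr v w) (x : abiset a), m = qcons x (qgrp 1%g).
Proof.
elim/qhom_ind: w / m => [//|u w a x m _] [/qlen0P[e [g ->]]].
case: u / e a x {m} => a x; exists a, (ract x g).
by rewrite qcons_bal qlact_grp mulg1.
Qed.

Lemma qiso (v w : Q) (m : @hom CQ v w) : is_iso m = (qlen m == 0).
Proof.
apply/existsP/eqP => [[m' /andP[/eqP e _]]|/qlen0P[e [g ->]]].
  by apply/eqP; have /eqP := qlen_endo (qcomp m' m); rewrite qlen_comp addn_eq0 => /andP[].
case: w / e {m}; exists (qgrp g^-1%g).
by rewrite /= !qcomp_grp !qlact_grp mulgV mulVg eqxx.
Qed.

Lemma quiver_cat_EI : EI_category CQ.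
Proof. by move=> v m; rewrite qiso qlen_endo. Qed.

Lemma qunfactorizable (v w : Q) (m : @hom CQ v w) :
  unfactorizable m = (qlen m == 1).
Proof.
apply/andP/eqP => [[]|len1]; rewrite !qiso; last first.
  split; first by rewrite len1.
  apply/'forall_'forall_'forall_implyP => u b c /eqP e.
  by move: len1; rewrite e qlen_comp !qiso; case: (qlen c) => [|[|?]]; case: (qlen b).
elim/qhom_ind: w / m => [//|u w a x m _ _ /'forall_'forall_'forall_implyP unf].
have /unf : qcons x m == qcomp (qcons x (qgrp 1%g)) m by rewrite qcomp_cons qcomp1m.
by rewrite !qiso orbF qlen_cons => /eqP->.
Qed.

Lemma quiver_cat_free : free_EI_category CQ.
Proof.
split; first exact: quiver_cat_EI.
exists Q, (@Functor CQ CQ id (fun _ _ => id) (fun=> erefl) (fun _ _ _ _ _ => erefl)).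
by split=> [|x y]; exists id.
Qed.

End QuiverCatTheory.

Section IsoTheory.
Variable C : finCat.

Lemma isoP (x y : C) (f : hom x y) :
  reflect (exists2 g : hom y x, g \oc f = idm x & f \oc g = idm y) (is_iso f).
Proof.
apply: (iffP existsP) => [[g /andP[/eqP e1 /eqP e2]]|[g e1 e2]]; first by exists g.
by exists g; rewrite e1 e2 !eqxx.
Qed.

Lemma iso_lr (x y : C) (f : hom x y) (g h : hom y x) :
  g \oc f = idm x -> f \oc h = idm y -> is_iso f.
Proof.
move=> e1 e2; apply/isoP; exists g => //.
suff -> : g = h by [].
by rewrite -[g]compm1 -e2 compmA e1 comp1m.
Qed.

Lemma iso1 (x : C) : is_iso (idm x).
Proof. by apply/isoP; exists (idm x); rewrite comp1m. Qed.

Lemma isoM (x y z : C) (g : hom y z) (f : hom x y) :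
  is_iso g -> is_iso f -> is_iso (g \oc f).
Proof.
move=> /isoP[g' e1 e2] /isoP[f' e3 e4]; apply/isoP; exists (f' \oc g').
  by rewrite -compmA [g' \oc _]compmA e1 comp1m.
by rewrite -compmA [f \oc _]compmA e4 comp1m.
Qed.

Lemma iso_cancell (x y z : C) (g : hom y z) (f : hom x y) :
  is_iso g -> is_iso (g \oc f) -> is_iso f.
Proof.
move=> /isoP[g' e1 e2] isogf.
have -> : f = g' \oc (g \oc f) by rewrite compmA e1 comp1m.
by apply: isoM => //; apply/isoP; exists g.
Qed.

Lemma iso_cancelr (x y z : C) (g : hom y z) (f : hom x y) :
  is_iso f -> is_iso (g \oc f) -> is_iso g.
Proof.
move=> /isoP[f' e1 e2] isogf.
have -> : g = (g \oc f) \oc f' by rewrite -compmA e2 compm1.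
by apply: isoM => //; apply/isoP; exists f.
Qed.

Lemma EI_iso (x y : C) (f : hom x y) (g : hom y x) : EI_category C -> is_iso f.
Proof.
move=> EI; have /isoP[h e _] := EI _ (g \oc f); have /isoP[l _ e'] := EI _ (f \oc g).
by apply: (@iso_lr _ _ f (h \oc g) (g \oc l)); rewrite -?compmA // compmA.
Qed.

Lemma unfactorizable_iso (x y : C) (b : hom y y) (f : hom x y) (a : hom x x) :
  is_iso b -> is_iso a -> unfactorizable f -> unfactorizable (b \oc f \oc a).
Proof.
move=> isob isoa /andP[nisof /'forall_'forall_'forall_implyP unf]; apply/andP; split.
  by apply: contra nisof => /(iso_cancelr isoa) /(iso_cancell isob).
apply/'forall_'forall_'forall_implyP => z c d /eqP e.
have /isoP[b' b1 b2] := isob; have /isoP[a' a1 a2] := isoa.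
have /unf : f == (b' \oc d) \oc (c \oc a').
  rewrite -compmA [d \oc _]compmA -e -!compmA a2 compm1 !compmA b1 comp1m.
  by [].
have isob' : is_iso b' by apply/isoP; exists b.
have isoa' : is_iso a' by apply/isoP; exists a.
by case/orP=> [/(iso_cancelr isoa')->//|/(iso_cancell isob')->]; rewrite orbT.
Qed.

End IsoTheory.

Section Aut.
Variables (C : finCat) (x : C).

Definition aut : Type := {f : hom x x | is_iso f}.
HB.instance Definition _ := Finite.on aut.
HB.instance Definition _ := SubType.on aut.

Implicit Types f g : aut.

Definition aut_mul g f : aut := Sub (val g \oc val f) (isoM (valP g) (valP f)).
Definition aut_one : aut := Sub (idm x) (iso1 x).

Lemma aut_inv_subproof f : exists g : aut, aut_mul g f == aut_one.
Proof.
have /isoP[g e1 e2] := valP f.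
have isog : is_iso g by apply/isoP; exists (val f).
by exists (Sub g isog); apply/eqP/val_inj; rewrite /= e1.
Qed.
Definition aut_inv f : aut := xchoose (aut_inv_subproof f).

Lemma aut_mulA : associative aut_mul.
Proof. by move=> h g f; apply: val_inj; apply: compmA. Qed.
Lemma aut_mul1 : left_id aut_one aut_mul.
Proof. by move=> f; apply: val_inj; apply: comp1m. Qed.
Lemma aut_mulV : left_inverse aut_one aut_inv aut_mul.
Proof. by move=> f; apply/eqP; apply: (xchooseP (aut_inv_subproof f)). Qed.

HB.instance Definition _ := Finite_isGroup.Build aut aut_mulA aut_mul1 aut_mulV.

End Aut.

Section Cover.
Variable C : finCat.
Hypothesis EI : EI_category C.
Hypothesis skC : skeletal C.

(* The orbit of f under the (Aut y, Aut x)-action. *)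
Definition same_orbit (x y : C) (f f' : hom x y) : bool :=
  [exists b : aut y, exists a : aut x, f' == val b \oc f \oc val a].

Lemma same_orbitP (x y : C) (f f' : hom x y) :
  reflect (exists (b : aut y) (a : aut x), f' = val b \oc f \oc val a)
          (same_orbit f f').
Proof.
apply: (iffP existsP) => [[b /existsP[a /eqP e]]|[b [a e]]]; first by exists b, a.
by exists b; apply/existsP; exists a; apply/eqP.
Qed.

Lemma same_orbit_refl (x y : C) (f : hom x y) : same_orbit f f.
Proof. by apply/same_orbitP; exists 1%g, 1%g; rewrite compm1 comp1m. Qed.

Lemma val_autV (x : C) (a : aut x) : val a^-1%g \oc val a = idm x.
Proof. by have /(congr1 val) := mulVg a. Qed.

Lemma val_autVr (x : C) (a : aut x) : val a \oc val a^-1%g = idm x.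
Proof. by have /(congr1 val) := mulgV a. Qed.

Lemma same_orbit_sym (x y : C) (f f' : hom x y) : same_orbit f f' = same_orbit f' f.
Proof.
suff sub (g h : hom x y) : same_orbit g h -> same_orbit h g.
  by apply/idP/idP; apply: sub.
case/same_orbitP=> b [a ->]; apply/same_orbitP; exists b^-1%g, a^-1%g.
by rewrite -!compmA val_autVr compm1 compmA val_autV comp1m.
Qed.

Lemma same_orbit_lact (x y : C) (f f' : hom x y) (b : aut y) :
  same_orbit f f' -> same_orbit f (val b \oc f').
Proof.
case/same_orbitP=> b' [a ->]; apply/same_orbitP; exists (b * b')%g, a.
by rewrite /= !compmA.
Qed.

Lemma same_orbit_ract (x y : C) (f f' : hom x y) (a : aut x) :
  same_orbit f f' -> same_orbit f (f' \oc val a).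
Proof.
case/same_orbitP=> b [a' ->]; apply/same_orbitP; exists b, (a' * a)%g.
by rewrite /= !compmA.
Qed.

Lemma same_orbit_trans (x y : C) (f f' f'' : hom x y) :
  same_orbit f f' -> same_orbit f' f'' -> same_orbit f f''.
Proof.
move=> off' /same_orbitP[b [a ->]].
by apply: same_orbit_ract; apply: same_orbit_lact.
Qed.

Definition orbit_rep (x y : C) (f : hom x y) : hom x y :=
  odflt f [pick f' | same_orbit f f'].

Lemma orbit_repP (x y : C) (f : hom x y) : same_orbit f (orbit_rep f).
Proof.
rewrite /orbit_rep; case: pickP => [//|/(_ f)].
by rewrite same_orbit_refl.
Qed.

Lemma eq_orbit_rep (x y : C) (f f' : hom x y) :
  same_orbit f f' -> orbit_rep f = orbit_rep f'.
Proof.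
move=> off'; rewrite /orbit_rep (eq_pick (Q := same_orbit f')) => [|g].
  by case: pickP => [//|/(_ f')]; rewrite same_orbit_refl.
by apply/idP/idP; apply: same_orbit_trans; rewrite // same_orbit_sym.
Qed.

Definition rep_unfactorizable (x y : C) : finType :=
  {f : hom x y | unfactorizable f && (orbit_rep f == f)}.

Definition cover_quiver : quiver := Quiver rep_unfactorizable.

Lemma cover_quiver_acyclic : acyclic cover_quiver.
Proof.
have path_hom (v w : C) (p : @qpath cover_quiver v w) : exists f : hom v w, True.
  elim: p => [|u w' a p [f _]]; first by exists (idm v).
  by exists (val a \oc f).
suff nocycle (v w : cover_quiver) (p : qpath v w) : w = v -> plength p = 0.
  by move=> v p; apply: nocycle.
case: p => [//|u w' a p] e; subst w'; have [f _] := path_hom _ _ p.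
by have /andP[/andP[/negP[]]] := valP a; apply: EI_iso f EI.
Qed.

Section Orbit.
Variables (x y : C) (f : hom x y).

Definition orbit_car : finType := {f' : hom x y | same_orbit f f'}.

Definition orbit_lact (b : aut y) (f' : orbit_car) : orbit_car :=
  Sub (val b \oc val f') (same_orbit_lact b (valP f')).
Definition orbit_ract (f' : orbit_car) (a : aut x) : orbit_car :=
  Sub (val f' \oc val a) (same_orbit_ract a (valP f')).

Lemma orbit_lact1 f' : orbit_lact 1%g f' = f'.
Proof. by apply: val_inj; apply: comp1m. Qed.
Lemma orbit_lactM b c f' : orbit_lact (b * c)%g f' = orbit_lact b (orbit_lact c f').
Proof. by apply: val_inj; rewrite /= compmA. Qed.
Lemma orbit_ract1 f' : orbit_ract f' 1%g = f'.
Proof. by apply: val_inj; apply: compm1. Qed.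
Lemma orbit_ractM f' a c : orbit_ract f' (a * c)%g = orbit_ract (orbit_ract f' a) c.
Proof. by apply: val_inj; apply: compmA. Qed.
Lemma orbit_lractA b f' a :
  orbit_ract (orbit_lact b f') a = orbit_lact b (orbit_ract f' a).
Proof. by apply: val_inj; rewrite /= compmA. Qed.

Definition orbit_biset : biset (aut y) (aut x) :=
  @Biset (aut y) (aut x) orbit_car orbit_lact orbit_ract
    orbit_lact1 orbit_lactM orbit_ract1 orbit_ractM orbit_lractA.
End Orbit.

Definition cover_EI_quiver : EI_quiver :=
  @EIQuiver cover_quiver cover_quiver_acyclic (fun x => aut x)
    (fun x y (a : rep_unfactorizable x y) => orbit_biset (val a)).

Definition cover_cat : finCat := quiver_cat cover_EI_quiver.

Local Notation CQ := cover_EI_quiver.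

Fixpoint eval_path (v w : CQ) (p : qpath v w) : path_biset p -> @hom C v w :=
  match p in qpath _ w return path_biset p -> @hom C v w with
  | path_nil => fun g : aut v => val g
  | path_cons _ _ a p' => fun q =>
      val (generic_quotient.repr q).1 \oc
        @eval_path v _ p' (generic_quotient.repr q).2
  end.

Definition eval (v w : CQ) (m : qhom v w) : @hom C v w := eval_path (tagged m).

Lemma eval_path_lact (v w : CQ) (p : qpath v w) (g : aut w) (h : path_biset p) :
  eval_path (lact (g : vgroup w) h) = val g \oc eval_path h.
Proof.
elim: p => [//|u w' a p IHp] in g h *.
set x := (generic_quotient.repr h).1; set y := (generic_quotient.repr h).2.
have /bprod_mkP[l [e1 e2]] := bprod_repr (bprod_mk (lact (g : vgroup w') x) y).
by rewrite /= e1 -/y [y in RHS]e2 IHp /= !compmA.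
Qed.

Lemma eval_grp (v : CQ) (g : aut v) : eval (qgrp (g : vgroup v)) = val g.
Proof. by []. Qed.

Lemma eval_lact (v w : CQ) (g : aut w) (m : qhom v w) :
  eval (qlact (g : vgroup w) m) = val g \oc eval m.
Proof. exact: eval_path_lact. Qed.

Lemma eval_cons (v u w : CQ) (a : arr u w) (x : abiset a) (m : qhom v u) :
  eval (qcons x m) = val x \oc eval m.
Proof.
have /bprod_mkP[l [e1 e2]] := bprod_repr (bprod_mk x (tagged m)).
by rewrite /eval /= e1 [tagged m in RHS]e2 eval_path_lact /= compmA.
Qed.

Lemma eval1 (v : cover_cat) : eval (idm v) = @idm C v.
Proof. by []. Qed.

Lemma evalM (v u w : cover_cat) (m2 : hom u w) (m1 : hom v u) :
  eval (m2 \oc m1) = @comp C _ _ _ (eval m2) (eval m1).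
Proof.
rewrite /=; elim/qhom_ind: w / m2 => [g|u' w a x m IHm].
  by rewrite qcomp_grp eval_lact.
by rewrite qcomp_cons !eval_cons IHm compmA.
Qed.

Definition cover_functor : functor cover_cat C :=
  @Functor cover_cat C id eval eval1 evalM.

Lemma eval_iso (v w : cover_cat) : 
  bij_between (@is_iso cover_cat v w) (@is_iso C v w) (@eval v w).
Proof.
split=> [m /isoP[m' e1 e2]|m m'|f isof].
- by apply/isoP; exists (eval m'); rewrite -evalM ?e1 ?e2.
- rewrite !qiso => /eqP/qlen0P[e [g ->]] {m}; case: w / e m' => m' _.
  by have [g' ->] := qhom_endoP m'; rewrite !eval_grp => /val_inj->.
- have e : v = w by apply: skC; exists f.
  case: w / e f isof => f isof; exists (qgrp (Sub f isof : vgroup (v : CQ))) => //.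
  by rewrite qiso.
Qed.

Lemma orbit_unfactorizable (x y : C) (f f' : hom x y) :
  same_orbit f f' -> unfactorizable f -> unfactorizable f'.
Proof. by case/same_orbitP=> b [a ->]; apply: unfactorizable_iso; apply: valP. Qed.

Lemma eval_arrow (v w : CQ) (a : arr v w) (x : abiset a) :
  eval (qcons x (qgrp 1%g)) = val x.
Proof. by rewrite eval_cons eval_grp compm1. Qed.

Lemma eval_unfactorizable (v w : cover_cat) :
  bij_between (@unfactorizable cover_cat v w) (@unfactorizable C v w) (@eval v w).
Proof.
split=> [m|m m'|f unff].
- rewrite qunfactorizable => /eqP/qlen1P[a [x ->]]; rewrite eval_arrow.
  by apply: orbit_unfactorizable (valP x) _; have /andP[] := valP a.
- rewrite !qunfactorizable => /eqP/qlen1P[a [x ->]] /eqP/qlen1P[a' [x' ->]].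
  rewrite !eval_arrow => exx'; have eaa' : a = a'.
    apply: val_inj; have /andP[_ /eqP<-] := valP a; have /andP[_ /eqP<-] := valP a'.
    apply: eq_orbit_rep; apply: same_orbit_trans (valP x) _.
    by rewrite exx' same_orbit_sym; apply: (valP x').
  by case: a' / eaa' x' exx' => x' /val_inj->.
- have repf := orbit_repP f.
  have repP : unfactorizable (orbit_rep f) && (orbit_rep (orbit_rep f) == orbit_rep f).
    by rewrite (orbit_unfactorizable repf unff) -(eq_orbit_rep repf) eqxx.
  pose a : @arr CQ v w := Sub (orbit_rep f) repP.
  have fa : same_orbit (val a) f by rewrite same_orbit_sym.
  exists (qcons (Sub f fa : abiset a) (qgrp 1%g)); first by rewrite qunfactorizable.
  by rewrite eval_arrow.
Qed.

Lemma cover_full : full cover_functor.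
Proof.
move=> v w f /=; rewrite /= in v w f *.
pose between (x y : C) := [set z : C | (0 < #|hom x z|) && (0 < #|hom z y|)].
have betweenP (x y z : C) (g : hom x z) (h : hom z y) : z \in between x y.
  by rewrite inE; apply/andP; split; apply/card_gt0P; [exists g|exists h].
suff main n (x y : C) (g : hom x y) : #|between x y| < n ->
    exists m : @qhom CQ x y, eval m = g by exact: main (ltnSn _).
elim: n => // n IHn in x y g *; rewrite ltnS => len.
have [isog|nisog] := boolP (is_iso g).
  by have [_ _ /(_ g isog)[m _ <-]] := eval_iso x y; exists m.
have [unfg|] := boolP (unfactorizable g).
  by have [_ _ /(_ g unfg)[m _ <-]] := eval_unfactorizable x y; exists m.
rewrite /unfactorizable nisog /= => /forallPn[z /forallPn[b /forallPn[c]]].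
rewrite negb_imply negb_or => /and3P[/eqP-> nisob nisoc].
have lt1 : #|between x z| < n.
  apply: leq_trans len; apply: proper_card; apply/properP; split.
    apply/subsetP => u; rewrite inE => /andP[/card_gt0P[h _] /card_gt0P[h' _]].
    exact: betweenP h (c \oc h').
  exists y; first exact: betweenP (c \oc b) (idm y).
  rewrite inE; apply: contra nisoc => /andP[_ /card_gt0P[h _]].
  exact: EI_iso h EI.
have lt2 : #|between z y| < n.
  apply: leq_trans len; apply: proper_card; apply/properP; split.
    apply/subsetP => u; rewrite inE => /andP[/card_gt0P[h _] /card_gt0P[h' _]].
    exact: betweenP (h \oc b) h'.
  exists x; first exact: betweenP (idm x) (c \oc b).
  rewrite inE; apply: contra nisob => /andP[/card_gt0P[h _] _].
  exact: EI_iso h EI.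
have [m1 <-] := IHn _ _ b lt1; have [m2 <-] := IHn _ _ c lt2.
by exists (qcomp m2 m1); rewrite -(evalM m2 m1).
Qed.

Theorem cover_cat_free_EI_cover : free_EI_cover cover_cat C.
Proof.
split; first exact: quiver_cat_free.
exists cover_functor; split; first exact: cover_full.
- by exists id.
- exact: eval_iso.
- exact: eval_unfactorizable.
Qed.

End Cover.

(* Main.v *)
(* A functor that is injective on objects sends non-composable pairs to
   non-composable pairs, so its k-linear extension is multiplicative; the cover
   functor is moreover bijective on objects, hence preserves the unit, and full,
   hence gives a surjection phi.  Restriction of scalars along phi preserves
   finite generation and indecomposability and reflects isomorphism, because
   M and its restriction have the same submodules and linear maps. *)
Require Import Defs.
From HB Require Import structures.
From mathcomp Require Import all_boot all_order all_algebra.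
From Stdlib Require Import Classical IndefiniteDescription.

Set Implicit Arguments.
Unset Strict Implicit.
Unset Printing Implicit Defensive.
Import GRing.Theory.
Local Open Scope ring_scope.

Section FunctorAlgebra.
Variables (k : fieldType) (D C : finCat) (F : functor D C).
Implicit Types a b : cat_alg k D.

Local Notation coef a m := (cat_alg_coef a m).
Local Notation e := (@cat_alg_basis k _).

Definition mor_map (m : mor D) : mor C := Mor (fmap F (tagged m)).

Definition alg_map a : cat_alg k C := \sum_(m : mor D) coef a m *: e (mor_map m).

Lemma alg_map_is_linear : linear alg_map.
Proof.
move=> l a b; rewrite /alg_map scaler_sumr -big_split; apply: eq_bigr => m _.
by rewrite Defs.coefD Defs.coefZ scalerDl scalerA.
Qed.

HB.instance Definition _ :=
  GRing.isLinear.Build k (cat_alg k D) (cat_alg k C) *:%R alg_map alg_map_is_linear.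

Lemma alg_map_basis m : alg_map (e m) = e (mor_map m).
Proof.
rewrite /alg_map (bigD1 m) //= big1 => [|m' ne]; rewrite /cat_alg_coef ffunE.
  by rewrite eqxx scale1r addr0.
by rewrite (negPf ne) scale0r.
Qed.

Lemma alg_mapM : injective F -> {morph alg_map : a b / a * b}.
Proof.
move=> injF a b.
have basisM m1 m2 : alg_map (e m1 * e m2) = alg_map (e m1) * alg_map (e m2).
  rewrite !alg_map_basis; case: m1 m2 => -[y' z] g [[x y] f]; rewrite /= in g f *.
  have [eqy|ne] := eqVneq y y'.
    case: y' / eqy g => g.
    by rewrite cat_alg_basisM alg_map_basis /mor_map /= fmapM cat_alg_basisM.
  by rewrite !cat_alg_basisM0 ?linear0 // (inj_eq injF).
rewrite [a]cat_alg_basisE [b]cat_alg_basisE !linear_sum /= !mulr_suml linear_sum.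
apply: eq_bigr => m1 _; rewrite !mulr_sumr linear_sum; apply: eq_bigr => m2 _ /=.
by rewrite -cat_alg_scalerAl -cat_alg_scalerAr !linearZ /= basisM
  -cat_alg_scalerAl -cat_alg_scalerAr.
Qed.

Lemma alg_map1 : bijective F -> alg_map 1 = 1.
Proof.
move=> bijF; rewrite /GRing.one /= /cat_alg_one linear_sum /=.
rewrite [RHS](reindex _ (onW_bij _ bijF)); apply: eq_bigr => x _.
by rewrite alg_map_basis /mor_map /= fmap1.
Qed.

Lemma mor_map_surj : bijective F -> full F -> forall m, exists m', mor_map m' = m.
Proof.
move=> [G _ FK] fullF [[x y] /= f].
have [[x' ex] [y' ey]] : (exists x', F x' = x) /\ (exists y', F y' = y).
  by split; [exists (G x) | exists (G y)].
subst x y.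
have [g <-] := fullF _ _ f; by exists (Mor g).
Qed.

Lemma alg_map_surj : bijective F -> full F -> forall c, exists a, alg_map a = c.
Proof.
move=> bijF fullF c; have [g gK] := functional_choice _ (mor_map_surj bijF fullF).
exists (\sum_m coef c m *: e (g m)); rewrite [RHS]cat_alg_basisE linear_sum.
by apply: eq_bigr => m _; rewrite linearZ /= alg_map_basis gK.
Qed.

Lemma quotient_cat_alg_of_full :
  bijective F -> full F -> is_quotient_cat_alg k C D.
Proof.
move=> bijF fullF.
pose isM := GRing.isMonoidMorphism.Build _ _ alg_map
  (alg_map1 bijF, alg_mapM (bij_inj bijF)).
pose phi : {rmorphism cat_alg k D -> cat_alg k C} := HB.pack alg_map isM.
by exists phi; split; [exact: (linearZZ alg_map) | exact: alg_map_surj].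
Qed.

End FunctorAlgebra.

Section RestrictionOfScalars.
Variables (A B : pzRingType) (phi : {rmorphism A -> B}).

Definition restr (M : lmodType B) : Type := M.

Section Module.
Variable M : lmodType B.

HB.instance Definition _ := GRing.Zmodule.on (restr M).

Definition restr_scale (a : A) (m : restr M) : restr M := phi a *: (m : M).

Lemma restr_scaleA a b m : restr_scale a (restr_scale b m) = restr_scale (a * b) m.
Proof. by rewrite /restr_scale rmorphM scalerA. Qed.

Lemma restr_scale1 : left_id 1 restr_scale.
Proof. by move=> m; rewrite /restr_scale rmorph1 scale1r. Qed.

Lemma restr_scaleDr : right_distributive restr_scale +%R.
Proof. by move=> a m n; apply: scalerDr. Qed.

Lemma restr_scaleDl m : {morph restr_scale^~ m : a b / a + b}.
Proof. by move=> a b; rewrite /restr_scale rmorphD scalerDl. Qed.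

HB.instance Definition _ := GRing.Zmodule_isLmodule.Build A (restr M)
  restr_scaleA restr_scale1 restr_scaleDr restr_scaleDl.

End Module.

Hypothesis phi_surj : forall b, exists a, phi a = b.

Lemma restr_finitely_generated (M : lmodType B) :
  finitely_generated M -> finitely_generated (restr M : lmodType A).
Proof.
move=> [n [e gen]]; exists n, e => m; have [c ->] := gen m.
have [d dK] := functional_choice _ (fun i => phi_surj (c i)).
by exists d; apply: eq_bigr => i _; rewrite /GRing.scale /= /restr_scale dK.
Qed.

Lemma restr_submodule (M : lmodType B) (U : M -> Prop) :
  submodule (U : (restr M : lmodType A) -> Prop) -> submodule U.
Proof. by move=> [U0 UP]; split=> // b u v; have [a <-] := phi_surj b; apply: UP. Qed.

Lemma restr_indecomposable (M : lmodType B) :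
  indecomposable M -> indecomposable (restr M : lmodType A).
Proof.
move=> [nz ind]; split=> // U V subU subV; apply: ind; exact: restr_submodule.
Qed.

Lemma restr_iso_reflect (M M' : lmodType B) (N : lmodType A) :
  module_isomorphic (restr M : lmodType A) N ->
  module_isomorphic (restr M' : lmodType A) N -> module_isomorphic M M'.
Proof.
move=> [f bijf] [f' [g' f'K g'K]].
pose h (m : M) : M' := g' (f m).
have h_linear : linear h.
  move=> b u v; have [a <-] := phi_surj b; apply: (can_inj f'K).
  rewrite g'K (linearP f a u v : f (phi a *: u + v) = _).
  by rewrite (linearP f' a _ _ : f' (phi a *: h u + h v) = _) !g'K.
pose hL : {linear M -> M'} := HB.pack h (GRing.isLinear.Build _ _ _ _ h h_linear).
by exists hL; apply: (bij_comp _ bijf); exists f'.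
Qed.

Lemma finite_rep_type_quotient : finite_rep_type A -> finite_rep_type B.
Proof.
move=> [n [N [_ Nall]]].
pose good (M : lmodType B) := finitely_generated M /\ indecomposable M.
have [[M0 good0]|none] := classic (exists M, good M); last first.
  exists 0%N, (fun=> B^o : lmodType B); split=> [[]//|M fgM indM].
  by case: none; exists M.
pose matches i M := module_isomorphic (restr M : lmodType A) (N i).
have [i|N' N'P] := functional_choice (fun i M => good M /\
    ((exists2 M', good M' & matches i M') -> matches i M)).
  have [[M goodM iMN]|no] := classic (exists2 M, good M & matches i M).
    by exists M.
  by exists M0.
exists n, N'; split=> [i|M fgM indM]; first by have [] := N'P i.
have [i iMN] := Nall _ (restr_finitely_generated fgM) (restr_indecomposable indM).
exists i; apply: (restr_iso_reflect iMN); have [_ N'iso] := N'P i.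
by apply: N'iso; exists M.
Qed.

End RestrictionOfScalars.

Theorem proposition2p13 (k : closedFieldType) (C Chat : finCat)
    (C_EI : EI_category C) (C_skeletal : skeletal C) (C_connected : connected C)
    (Chat_cover : free_EI_cover Chat C) :
  is_quotient_cat_alg k C Chat /\
  (finite_rep_type (cat_alg k Chat) -> finite_rep_type (cat_alg k C)).
Proof.
have [_ [F [fullF bijF _ _]]] := Chat_cover.
have quot := quotient_cat_alg_of_full k bijF fullF.
split=> //; have [phi [_ phi_surj]] := quot.
exact: finite_rep_type_quotient phi_surj.
Qed.
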